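(* The following hold. (i) For every positive integer $n$ and every positive integer $k$, if $q\geq 3n^{2^k/(2^k-1)}$ then $\mathcal{P}(n,q)<2k$. (ii) There is $n_0$ such that for all $n\ge n_0$: if $q\geq n$ then $\mathcal{P}(n,q)<3\ln\ln n$. (iii) There is $\epsilon_0>0$ such that for every $0<\epsilon<\epsilon_0$ there is $n_0$ such that for every $n>n_0$: if $q\leq(1-\epsilon)\dfrac{n}{2}$ then $\mathcal{P}(n,q)\geq e^{-12/\epsilon}n$. (iv) There is $\epsilon_0>0$ such that for every $0<\epsilon<\epsilon_0$ there is $n_0$ such that for every $n>n_0$: if $q\leq\epsilon n$ then $\mathcal{P}(n,q)\geq (1-4\epsilon\ln(1/\epsilon))n$. Here $q$ always denotes a positive integer.
   Context: Client-Waiter game on a board $X$ with bias $q$ (a positive integer): two players, Client and Waiter, play in turns. In each turn Waiter offers Client a set of at least $1$ and at most $q+1$ unclaimed elements of $X$; Client claims exactly one of the offered elements and Waiter claims all the other offered elements. The game ends when all elements of $X$ have been claimed. When $X=E(G)$ for a graph $G$, Client's graph is the graph on $V(G)$ whose edges are the edges claimed by Client. $\mathcal{P}(n,q)$ denotes the largest integer $\ell$ such that, in the Client-Waiter game with bias $q$ on $E(K_n)$, Client has a strategy guaranteeing (against any play of Waiter) that at the end of the game his graph contains a path of length (number of edges) at least $\ell$. *)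

(* Defs.v *)
From HB Require Import structures.
From mathcomp Require Import all_boot all_order all_algebra.
From mathcomp Require Import boolp reals sequences exp.

Set Implicit Arguments.
Unset Strict Implicit.
Unset Printing Implicit Defensive.

Section ClientWaiter.
Variable T : finType.

(* Given the rounds played so far, as pairs (offered set, element claimed by
   Client), and the set currently offered, the element that Client claims. *)
Definition client_strategy := seq ({set T} * T) -> {set T} -> T.

Definition legal_strategy (s : client_strategy) : Prop :=
  forall h (A : {set T}), A != set0 -> s h A \in A.

(* The successive offers [os] of Waiter form a complete play with bias [q] when
   [U] is the set of unclaimed elements. The chosen element does not matter
   here: every offered element is claimed by one of the players. Against a fixed
   strategy of Client, adaptive play of Waiter amounts to such a sequence. *)
Fixpoint legal_play (q : nat) (U : {set T}) (os : seq {set T}) : bool :=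
  if os is A :: os' then
    [&& A \subset U, 1 <= #|A|, #|A| <= q.+1 & legal_play q (U :\: A) os']
  else U == set0.

Fixpoint client_claims (s : client_strategy) (h : seq ({set T} * T))
    (os : seq {set T}) : {set T} :=
  if os is A :: os' then
    s h A |: client_claims s (rcons h (A, s h A)) os'
  else set0.

Definition client_can_guarantee (q : nat) (X : {set T})
    (goal : {set T} -> Prop) : Prop :=
  exists2 s : client_strategy, legal_strategy s &
    forall os, legal_play q X os -> goal (client_claims s [::] os).

End ClientWaiter.

Definition complete_edges (n : nat) : {set {set 'I_n}} :=
  [set e : {set 'I_n} | #|e| == 2].

Definition adjacent (n : nat) (E : {set {set 'I_n}}) : rel 'I_n :=
  fun x y => [set x; y] \in E.

Definition has_path_of_length_ge (n l : nat) (E : {set {set 'I_n}}) : Prop :=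
  exists (x : 'I_n) (p : seq 'I_n),
    [/\ path (adjacent E) x p, uniq (x :: p) & l <= size p].

Definition client_guarantees_path (n q l : nat) : Prop :=
  client_can_guarantee q (complete_edges n) (@has_path_of_length_ge n l).

(* A path on n vertices has fewer than n edges, so that bounding l by n loses
   nothing; see [leq_longest_path]. *)
Definition longest_path (n q : nat) : nat :=
  \max_(l < n | `[< client_guarantees_path n q l >]) l.

Lemma legal_play_exists (T : finType) (q : nat) (U : {set T}) :
  exists os, legal_play q U os.
Proof.
move: {2}#|U| (erefl #|U|) => m; elim: m U => [|m IHm] U Um.
  by exists [::]; rewrite /= -cards_eq0 Um.
have [x xU] : exists x, x \in U by apply/card_gt0P; rewrite Um.
have [|os Hos] := IHm (U :\ x); first by have := cardsD1 x U; rewrite xU Um => -[].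
by exists ([set x] :: os); rewrite /= sub1set xU cards1 Hos.
Qed.

Lemma client_guarantees_path_lt (n q l : nat) :
  client_guarantees_path n q l -> l < n.
Proof.
move=> [s _ Hs]; have [os /Hs[x [p [_ Up lp]]]] :=
  legal_play_exists q (complete_edges n).
apply: leq_ltn_trans lp _; have := max_card (mem (x :: p)).
by rewrite (card_uniqP Up) card_ord.
Qed.

Lemma leq_longest_path (n q l : nat) : 0 < n ->
  l <= longest_path n q <-> client_guarantees_path n q l.
Proof.
move=> n_gt0; split=> [|Hl]; last first.
  have ln := client_guarantees_path_lt Hl.
  by apply: (@leq_bigmax_cond _ _ _ (Ordinal ln)); apply/asboolP.
have G0 : client_guarantees_path n q 0.
  exists (fun _ (A : {set {set 'I_n}}) => odflt set0 [pick e in A]).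
    move=> _ A /set0Pn[e eA]; case: pickP => //= A0.
    by rewrite A0 in eA.
  by move=> os _; exists (Ordinal n_gt0), [::].
have [|i Hi Ei] := @eq_bigmax_cond _
    [pred l : 'I_n | `[< client_guarantees_path n q l >]] (@nat_of_ord n).
  by apply/card_gt0P; exists (Ordinal n_gt0); apply/asboolP.
have /asboolP[s sL Hs] := Hi.
rewrite (_ : longest_path n q = i) => [li|]; last by rewrite -Ei.
exists s => // os /Hs[x [p [? ? ip]]].
by exists x, p; split=> //; apply: leq_trans ip.
Qed.

(* Main.v *)
Require Import Defs.
From HB Require Import structures.
From mathcomp Require Import all_boot all_order all_algebra.
From mathcomp Require Import boolp reals sequences exp.
From mathcomp Require Import zify ring lra.

(* (i), (ii): Waiter keeps a set U of vertices that are isolated in Client's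
   graph and a set W of other live vertices, and repeatedly offers all the
   unclaimed edges at r vertices of U. Client's edge makes one of these r
   vertices a leaf for ever and moves at most one vertex from U to W, so that at
   the end of the round only the edges inside W are unclaimed, and (r + 1) |W| is
   at most the number z of vertices. A path of
   Client's graph of length at least 3 runs inside W except for its two end
   edges. With r = q / z rounded down, |W| <= z^2 / q, so z / q is squared in
   each round; for q = n the first round is played with r = 1.

   (iii), (iv): Client derandomizes random choices by conditional expectations,
   and depth-first search turns expansion into long paths. For (iv), uniform
   random choices give an edge between any two disjoint sets of k vertices. For
   (iii), let Q >= q be about (1 - eps) n / 2. Client keeps the chosen element of
   an offer of size a only with probability a / (Q + 1). Then every edge is kept
   with probability 1 / (Q + 1), the edges of a given set are all kept with
   probability at most (Q + 1)^(-size), and about n / (1 - eps) edges are kept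
   in expectation. Deleting an edge from each small dense subgraph leaves a
   locally sparse graph with more than (1 + eps) n edges. In a vertex set W
   maximizing e(W) - (1 + eps) |W|, small sets have linearly many neighbours
   outside themselves. *)

Set Implicit Arguments.
Unset Strict Implicit.
Unset Printing Implicit Defensive.

(** * Waiter's strategy *)

Definition pairs (n : nat) (Z : {set 'I_n}) : {set {set 'I_n}} :=
  [set e : {set 'I_n} | (e \subset Z) && (#|e| == 2)].

Lemma pairs_setT n : complete_edges n = pairs setT.
Proof. by apply/setP=> e; rewrite !inE subsetT. Qed.

Lemma pairsS n (Y Z : {set 'I_n}) : Y \subset Z -> pairs Y \subset pairs Z.
Proof.
move=> YZ; apply/subsetP=> e; rewrite !inE => /andP[eY ->].
by rewrite (subset_trans eY YZ).
Qed.

Lemma card_pairs n (Z : {set 'I_n}) : #|pairs Z| = 'C(#|Z|, 2).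
Proof. exact: cards_draws. Qed.

Lemma claims_sub (T : finType) (q : nat) (s : client_strategy T) os h U :
  legal_strategy s -> legal_play q U os -> client_claims s h os \subset U.
Proof.
move=> sL; elim: os h U => [|A os IH] h U /=; first by rewrite sub0set.
case/and4P=> AU A0 _ Hos; rewrite subUset sub1set.
rewrite (subsetP AU) ?sL -?card_gt0 //=.
exact: subset_trans (IH _ _ Hos) (subsetDl _ _).
Qed.

Lemma ex_subset_card (T : finType) (U : {set T}) (r : nat) :
  exists2 X : {set T}, X \subset U & #|X| = minn r #|U|.
Proof.
exists [set x in take r (enum U)].
  by apply/subsetP=> x; rewrite inE => /mem_take; rewrite mem_enum.
rewrite cardsE; have /card_uniqP -> : uniq (take r (enum U)).
  by rewrite take_uniq ?enum_uniq.
by rewrite size_take_min -cardE.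
Qed.

Definition leaves_outside n (W : {set 'I_n}) (G : {set {set 'I_n}}) : Prop :=
  forall e, e \in G -> ~~ (e \subset W) ->
    exists2 x, x \in e :\: W & forall f, f \in G -> x \in f -> f = e.

(** Both ends of an interior edge of a path have degree at least two, so such an edge lies inside
    [W]. Only the first and the last edge are lost. *)
Lemma path_leaves_outside n (W : {set 'I_n}) (G : {set {set 'I_n}}) l :
  leaves_outside W G -> G \subset pairs setT ->
  has_path_of_length_ge l.+4 G -> has_path_of_length_ge l.+2 (G :&: pairs W).
Proof.
move=> HG GP [x [p [pP pU lp]]].
have neq a b : Defs.adjacent G a b -> a != b.
  move=> /(subsetP GP); rewrite !inE => /andP[_].
  by rewrite cards2; case: (a == b).
have not_leaf a b c e : Defs.adjacent G a b -> Defs.adjacent G b c -> a != c ->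
    ~ (forall f, f \in G -> b \in f -> f = e).
  move=> ab bc ac Hf.
  have E : [set a; b] = [set b; c].
    have -> : [set a; b] = e by apply: (Hf _ ab); apply: set22.
    by apply/esym/(Hf _ bc); apply: set21.
  have := set21 a b; rewrite E !inE (negPf ac) orbF.
  by rewrite (negPf (neq _ _ ab)).
have mid a b c d : Defs.adjacent G a b -> Defs.adjacent G b c ->
    Defs.adjacent G c d -> a != c -> b != d -> [set b; c] \in G :&: pairs W.
  move=> ab bc cd ac bd.
  rewrite inE; apply/andP; split; first exact: bc.
  rewrite inE cards2 neq // andbT.
  apply/negPn/negP => bcW.
  have [z] := HG _ bc bcW; rewrite !inE => /andP[_ /orP[]/eqP-> Hz].
    exact: not_leaf ab bc ac Hz.
  exact: not_leaf bc cd bd Hz.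
have interior p' y a z : path (Defs.adjacent G) y (a :: rcons p' z) ->
    uniq (y :: a :: rcons p' z) -> path (Defs.adjacent (G :&: pairs W)) a p'.
  elim: p' y a => [//|b p' IH] y a /= /andP[ya abP] /andP[yN abU].
  rewrite (IH _ _ abP abU) andbT.
  case/andP: abP => ab; case/andP: abU => aN _.
  have yb : y != b by apply: contraNneq yN => ->; rewrite !inE eqxx !orbT.
  case: p' aN {IH yN} => [|c p'] /= aN /andP[bc _]; apply: (mid y a b _ ya ab bc yb).
    by apply: contraNneq aN => ->; rewrite !inE eqxx !orbT.
  by apply: contraNneq aN => ->; rewrite !inE eqxx !orbT.
case: p pP pU lp => // a p; case/lastP: p => // p z pP pU.
rewrite /= size_rcons !ltnS => lp.
exists a, p; split=> //; first exact: interior pP pU.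
move: pU => /= /andP[_]; rewrite mem_rcons inE rcons_uniq negb_or.
by case/andP=> /andP[_ ->] /andP[_ ->].
Qed.

Section Waiter.
Variables (n q : nat) (s : client_strategy {set 'I_n}).
Hypothesis sL : legal_strategy s.

(* The set [U] consists of vertices that are isolated in Client's graph. Waiter
   offers all edges at [r] vertices of [U]; Client's edge turns one of them into
   a leaf, and its neighbour is moved from [U] to [W]. *)
Lemma waiter_leaf_round (r k N : nat) : 0 < r ->
  (forall h (W : {set 'I_n}), r.+1 * #|W| <= N ->
     exists2 os, legal_play q (pairs W) os &
     ~ has_path_of_length_ge k (client_claims s h os)) ->
  forall h (U W : {set 'I_n}), [disjoint U & W] -> r * #|U :|: W| <= q.+1 ->
    r.+1 * #|W| + #|U| <= N ->
  exists os (W' : {set 'I_n}), [/\ legal_play q (pairs (U :|: W)) os,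
     W \subset W' /\ W' \subset U :|: W,
     leaves_outside W' (client_claims s h os) &
     ~ has_path_of_length_ge k (client_claims s h os :&: pairs W')].
Proof.
move=> r0 Hk h U; have [m] := ubnP #|U|; elim: m h U => // m IH h U Um W UW rq rN.
have [U0|Un0] := eqVneq U set0.
  move: rN; rewrite U0 cards0 addn0 set0U => /Hk-/(_ h)[os osL Hos].
  have sub := claims_sub h sL osL.
  exists os, W; split=> //; rewrite ?set0U //; last by rewrite (setIidPl sub).
  by move=> e /(subsetP sub); rewrite inE => /andP[-> _].
have [X XU cX] := ex_subset_card U r.
have X0 : 0 < #|X| by rewrite cX leq_min r0 card_gt0.
set Z := U :|: W in rq *.
pose A := pairs Z :\: pairs (Z :\: X).
have XZ : X \subset Z by rewrite (subset_trans XU) ?subsetUl.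
have WX : [disjoint W & X] by rewrite disjoint_sym (disjointWl XU).
have AE : pairs Z :\: A = pairs (Z :\: X).
  by rewrite setDDr setDv set0U; apply/setIidPr/pairsS/subsetDl.
have cA : #|A| <= q.+1.
  have AI : A \subset [set [set z.1; z.2] | z in setX X Z].
    apply/subsetP=> e; rewrite !inE => /andP[+ /andP[eZ c2]].
    rewrite c2 andbT subsetD eZ /= => /pred0Pn[x /= /andP[xe xX]].
    have /cards1P[y ey] : #|e :\ x| == 1 by rewrite (cardsD1 x) xe in c2.
    apply/imsetP; exists (x, y); last by rewrite /= -ey setD1K.
    have : y \in e :\ x by rewrite ey set11.
    by rewrite !inE xX /= => /andP[_ /(subsetP eZ)]; rewrite !inE.
  apply: leq_trans rq; apply: leq_trans (subset_leq_card AI) _.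
  apply: leq_trans (leq_imset_card _ _) _.
  by rewrite cardsX leq_mul2r cX geq_minl orbT.
have cUX : #|U :\: X| = #|U| - #|X| by rewrite cardsD (setIidPr XU).
have cUXlt : #|U :\: X| < m.
  rewrite cUX ltnS in Um *; apply: leq_trans Um.
  by rewrite -subn_gt0 subKn ?subset_leq_card.
(* Waiter may not offer the empty set; if no pair inside [Z] meets [X], he simply drops [X]. *)
have [A0|An0] := eqVneq A set0.
  have ZE : pairs Z = pairs (U :\: X :|: W).
    by rewrite -[LHS](setD0) -A0 AE setDUl (setDidPl WX).
  have [|||os [V [osL [WV VZ] lV HV]]] := IH h _ cUXlt W.
  - by rewrite (disjointWl (subsetDl _ _)).
  - by apply: leq_trans rq; rewrite leq_mul2l subset_leq_card ?orbT ?setSU ?subsetDl.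
  - by apply: leq_trans rN; rewrite leq_add2l subset_leq_card ?subsetDl.
  exists os, V; split=> //; first by rewrite ZE.
  by split=> //; rewrite (subset_trans VZ) // setSU ?subsetDl.
have := sL h An0; set e := s h A => eA.
have [eZ eX c2] : [/\ e \subset Z, ~~ (e \subset Z :\: X) & #|e| == 2].
  move: eA; rewrite !inE => /andP[+ /andP[eZ c2]].
  by rewrite c2 andbT.
have [x xe xX] : exists2 x, x \in e & x \in X.
  by move: eX; rewrite subsetD eZ => /pred0Pn[x /= /andP[]]; exists x.
have [y ey xy] : exists2 y, e = [set x; y] & y != x.
  have /cards1P[y ey] : #|e :\ x| == 1 by rewrite (cardsD1 x) xe in c2.
  exists y; first by rewrite -ey setD1K.
  by have : y \in e :\ x by [rewrite ey set11]; rewrite !inE => /andP[].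
have yZ : y \in Z by rewrite (subsetP eZ) // ey set22.
pose W' := if y \in X then W else y |: W.
pose U' := U :\: X :\ y.
have ZXE : Z :\: X = U' :|: W'.
  apply/setP=> z; rewrite /U' /W'; case: ifP => yX; rewrite !inE.
    have [->|zy] /= := eqVneq z y.
      by rewrite yX /= (disjointFr UW) // (subsetP XU).
    by case zX: (z \in X) => //=; rewrite (disjointFl WX).
  have [->|zy] /= := eqVneq z y.
    by rewrite yX; move: yZ; rewrite inE.
  by case zX: (z \in X) => //=; rewrite (disjointFl WX).
have UW' : [disjoint U' & W'].
  rewrite /U' /W'; case: ifP => yX.
    by rewrite (disjointWl _ UW) // (subset_trans (subsetDl _ _)) ?subsetDl.
  apply/pred0P=> z /=; rewrite !inE; have [//|zy] := eqVneq z y.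
  by case: (boolP (z \in U)) => zU; rewrite ?andbF // (disjointFr UW) ?andbF.
have WW' : W \subset W' by rewrite /W'; case: ifP; rewrite ?subsetUr.
have rN' : r.+1 * #|W'| + #|U'| <= N.
  apply: leq_trans rN; rewrite /W'; case: ifP => yX.
    by rewrite leq_add2l subset_leq_card // (subset_trans (subsetDl _ _)) ?subsetDl.
  have [yW|yW] := boolP (y \in W).
    rewrite (setUidPr _) ?sub1set // leq_add2l subset_leq_card //.
    by rewrite (subset_trans (subsetDl _ _)) ?subsetDl.
  (* Now [U] loses [r] vertices and [y], while [W] gains [y], so [r.+1 * #|W| + #|U|] is preserved;
     [y] outside [X] forces [#|X| = r]. *)
  have yU : y \in U :\: X by move: yZ; rewrite !inE (negPf yW) orbF yX.
  have := cardsD1 y (U :\: X); rewrite yU -/U' cUX => cU'.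
  rewrite cX in cU'; rewrite cardsU1 yW mulnDr muln1 -addnA addnCA leq_add2l.
  rewrite -(subnK (geq_minr r #|U|)) cU'.
  have /minn_idPl-> : r <= #|U|.
    by rewrite leqNgt; apply/negP => /ltnW/minn_idPr rU; rewrite rU subnn in cU'.
  by rewrite -/U' add1n addSnnS addnC.
have cU'm : #|U'| < m.
  by apply: leq_ltn_trans cUXlt; rewrite subset_leq_card // subsetDl.
have VZX : U' :|: W' \subset Z by rewrite -ZXE subsetDl.
have rq' : r * #|U' :|: W'| <= q.+1.
  by apply: leq_trans rq; rewrite leq_mul2l subset_leq_card ?orbT.
have [os [V [osL [W'V VUW'] lV HV]]] := IH (rcons h (A, e)) U' cU'm W' UW' rq' rN'.
have sub := claims_sub (rcons h (A, e)) sL osL.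
have xUW' : x \notin U' :|: W' by rewrite -ZXE inE xX.
have xV : x \notin V by apply: contra xUW'; apply: subsetP.
have xf f : f \in client_claims s (rcons h (A, e)) os -> x \notin f.
  move=> /(subsetP sub); rewrite inE => /andP[/subsetP fs _].
  by apply: contra xUW'; apply: fs.
exists (A :: os), V; split.
- by rewrite /= AE -/e subsetDl card_gt0 An0 cA /= ZXE.
- by split; [apply: subset_trans W'V | apply: subset_trans VZX].
- move=> f /=; rewrite -/e => /setU1P[->|fG] fV.
    exists x; first by rewrite !inE xe xV.
    by move=> g /setU1P[-> //|/xf/negP].
  (* A leaf [z] of a later edge remains a leaf after adding [e]: [x] is on no later edge, and if [z]
     were [y] it would lie in [W'], hence in [V]. *)
  have [z zfV Hz] := lV f fG fV; exists z => // g /setU1P[->|]; last exact: Hz.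
  move: zfV; rewrite ey !inE => /andP[zV zf] /orP[]/eqP zE.
    by have := xf f fG; rewrite -zE zf.
  have zUW' : z \in U' :|: W'.
    by have := subsetP sub f fG; rewrite inE => /andP[/subsetP/(_ z zf)].
  by move: zUW' zV; rewrite zE -ZXE inE => /andP[/negPf yX _];
     rewrite (subsetP W'V) // /W' yX setU11.
- rewrite /= -/e setIUl (_ : [set e] :&: _ = set0) ?set0U //.
  apply/setP=> f; rewrite !inE; case: eqP => //= ->.
  by apply/negP => /andP[/subsetP/(_ x xe)]; rewrite (negPf xV).
Qed.

(** Starting from [U = Z] and empty [W], the quantity [r.+1 * #|W| + #|U|] equals [#|Z|]. The two
    end edges of a path account for the drop from [l.+4] to [l.+2]. *)
Lemma waiter_step (r l : nat) h (Z : {set 'I_n}) : 0 < r -> r * #|Z| <= q.+1 ->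
  (forall h' (W : {set 'I_n}), r.+1 * #|W| <= #|Z| ->
    exists2 os, legal_play q (pairs W) os &
      ~ has_path_of_length_ge l.+2 (client_claims s h' os)) ->
  exists2 os, legal_play q (pairs Z) os &
    ~ has_path_of_length_ge l.+4 (client_claims s h os).
Proof.
move=> r0 rq HW.
have [|||os [W [osL _ lW HP]]] := waiter_leaf_round r0 HW h (U := Z) (W := set0).
- by rewrite -setI_eq0 setI0.
- by rewrite setU0.
- by rewrite cards0 muln0.
rewrite setU0 in osL; exists os => // HG; apply: HP.
apply: path_leaves_outside HG => //.
exact: subset_trans (claims_sub h sL osL) (pairsS (subsetT _)).
Qed.

(** For nonempty [Z] the hypothesis says that [q / #|Z|] to the power [2 ^ k.+1] exceeds [q]. A leaf
    round gives [#|W| * q <= #|Z| ^ 2], so the ratio is at least squared and half the exponent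
    suffices. In the base case [#|Z| ^ 2 < q], and one offer contains all pairs. *)
Lemma waiter_keeps_paths_short (k : nat) h (Z : {set 'I_n}) : #|Z| <= q ->
  #|Z| ^ (2 ^ k.+1) < q ^ (2 ^ k.+1).-1 ->
  exists2 os, legal_play q (pairs Z) os &
    ~ has_path_of_length_ge k.*2.+2 (client_claims s h os).
Proof.
elim: k h Z => [|k IH] h Z Zq.
  rewrite expn1 => Z2q.
  have [os osL [e Ge]] : exists2 os, legal_play q (pairs Z) os &
      exists e, client_claims s h os \subset [set e].
    have [Z0|Zn0] := eqVneq (pairs Z) set0.
      by exists [::]; [rewrite /= Z0 | exists set0; rewrite sub0set].
    exists [:: pairs Z]; last by exists (s h (pairs Z)); rewrite /= setU0.
    rewrite /= subxx card_gt0 Zn0 setDv eqxx andbT /= card_pairs bin2.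
    rewrite -divn2 (leq_trans (leq_div _ _)) // (leq_trans _ (ltnW (leqW Z2q))) //.
    by rewrite expnS expn1 leq_mul2l leq_pred orbT.
  exists os => // -[x [p [pP U]]].
  case: p pP U => [|y [|z p]] //= /and3P[xy yz _] U _.
  move: (subsetP Ge _ xy) (subsetP Ge _ yz) U; rewrite !inE => /eqP <- /eqP yzx.
  have := set21 x y; rewrite -yzx !inE => /orP[]/eqP-> ;
  by rewrite eqxx ?orbT.
have [Z0 _|Zn0] := posnP #|Z|.
  exists [::]; first by rewrite /= -cards_eq0 card_pairs Z0.
  by case=> x [[|y p] []] //= /andP[]; rewrite /Defs.adjacent inE.
move=> ZQ; apply: (@waiter_step (q %/ #|Z|)); first by rewrite divn_gt0.
  by apply: leq_trans (leq_trunc_div _ _) _.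
move=> h' W cW.
have lt_q : q < (q %/ #|Z|).+1 * #|Z| by rewrite ltn_ceil.
have WZ : #|W| * q <= #|Z| ^ 2.
  apply: (@leq_trans (#|W| * ((q %/ #|Z|).+1 * #|Z|))).
    by rewrite leq_mul2l ltnW ?orbT.
  by rewrite mulnA [#|W| * _]mulnC expnSr expn1 leq_mul2r cW orbT.
have WleZ : #|W| <= #|Z| by apply: leq_trans cW; rewrite leq_pmull.
apply: IH; first exact: leq_trans Zq.
have q0 : 0 < q by apply: leq_trans Zq.
have e0 : 0 < 2 ^ k.+1 by rewrite expn_gt0.
rewrite -(@ltn_pmul2r (q ^ (2 ^ k.+1))) ?expn_gt0 ?q0 //.
rewrite -expnMn -expnD; apply: (@leq_ltn_trans (#|Z| ^ (2 ^ k.+2))).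
  by rewrite [2 ^ k.+2]expnS expnM leq_exp2r.
apply: leq_trans ZQ _; rewrite leq_pexp2l // [2 ^ k.+2]expnS; lia.
Qed.

End Waiter.

Lemma longest_path_lt n q k : 0 < n -> (forall s : client_strategy {set 'I_n},
    legal_strategy s -> exists2 os, legal_play q (pairs setT) os &
      ~ has_path_of_length_ge k (client_claims s [::] os)) ->
  longest_path n q < k.
Proof.
move=> n0 H; rewrite ltnNge; apply/negP => /(leq_longest_path _ _ n0)[s sL sG].
by have [os osL] := H s sL; apply; apply: sG; rewrite pairs_setT.
Qed.

Lemma legal_play_mono (T : finType) q q' (U : {set T}) os : q <= q' ->
  legal_play q U os -> legal_play q' U os.
Proof.
move=> qq'; elim: os U => //= A os IH U /and4P[-> -> Aq /IH->]; rewrite andbT.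
exact: leq_trans Aq _.
Qed.

Lemma longest_path_anti n q q' : 0 < n -> q <= q' ->
  longest_path n q' <= longest_path n q.
Proof.
move=> n0 qq'; apply/leq_longest_path => //.
have /(leq_longest_path _ _ n0)[s sL sG] := leqnn (longest_path n q').
by exists s => // os osL; apply/sG/(legal_play_mono qq').
Qed.

Lemma longest_path_lt_of_large_bias n q k : 0 < n <= q -> 0 < k ->
  n ^ (2 ^ k) < q ^ (2 ^ k).-1 -> longest_path n q < 2 * k.
Proof.
case: k => // k /andP[n0 nq] _ H; apply: longest_path_lt => // s sL.
rewrite mulnS add2n mul2n; apply: waiter_keeps_paths_short => //;
by rewrite cardsT card_ord.
Qed.

(** By monotonicity one may take [q = n]. A first round with [r = 1] leaves at most half of the
    vertices in [W], and [n < 2 ^ (2 ^ k)] then yields the power inequality for [W]. *)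
Lemma longest_path_lt_of_linear_bias n q k : 1 < n <= q -> 0 < k ->
  n < 2 ^ (2 ^ k) -> longest_path n q < 2 * k.+1.
Proof.
case: k => // k /andP[n1 nq] _ H; have n0 : 0 < n by apply: ltnW.
apply: leq_ltn_trans (longest_path_anti n0 nq) _.
apply: longest_path_lt => // s sL; rewrite !mulnS !add2n mul2n.
apply: (@waiter_step _ _ _ sL 1) => //.
  by rewrite mul1n cardsT card_ord.
move=> h W; rewrite cardsT card_ord => Wn.
apply: waiter_keeps_paths_short => //; first by lia.
rewrite -(@ltn_pmul2l (2 ^ (2 ^ k.+1))) ?expn_gt0 // -expnMn.
apply: (@leq_ltn_trans (n ^ (2 ^ k.+1))).
  by rewrite leq_exp2r // expn_gt0.
rewrite -{1}[2 ^ k.+1]prednK ?expn_gt0 // expnS ltn_pmul2r //.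
by rewrite expn_gt0 n0.
Qed.

(** * Numerical estimates for (i) and (ii) *)

Import Order.TTheory GRing.Theory Num.Theory.
Local Open Scope ring_scope.

Lemma longest_path_lt_powR (R : realType) (n k q : nat) :
  (0 < n)%N -> (0 < k)%N ->
  3 * (n%:R `^ (2 ^+ k / (2 ^+ k - 1))) <= q%:R :> R ->
  (longest_path n q < 2 * k)%N.
Proof.
move=> n0 k0 Hq.
have e2 : (1 < 2 ^ k)%N by rewrite -{1}(expn0 2) ltn_exp2l.
have n1 : 1 <= n%:R :> R by rewrite ler1n.
have d0 : 0 < 2 ^+ k - 1 :> R by rewrite subr_gt0 -natrX ltr1n.
set a := _ / _ in Hq.
have a1 : 1 <= a by rewrite ler_pdivlMr // mul1r lerBlDr lerDl.
have na : n%:R <= n%:R `^ a by apply: le_trans (ler_powR n1 a1); rewrite powRr1.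
have nq : (n <= q)%N by rewrite -(ler_nat R); lra.
apply: longest_path_lt_of_large_bias; rewrite ?n0 //.
have nE : n%:R ^+ (2 ^ k) = (n%:R `^ a) ^+ (2 ^ k).-1 :> R.
  rewrite -!powR_mulrn ?powR_ge0 // -powRrM; congr (_ `^ _).
  by rewrite -subn1 natrB ?(ltnW e2) // natrX divfK // gt_eqF.
rewrite -(ltr_nat R) !natrX nE ltrXn2r ?nnegrE ?powR_ge0 //.
  by rewrite -lt0n -subn1 subn_gt0.
by lra.
Qed.

(** This makes 3 exceed [2 / ln 2], the coefficient of [ln (ln n)] that the doubly exponential bound
    gives. *)
Lemma ln2_gt23 (R : realType) : 2 / 3 < ln 2 :> R.
Proof.
rewrite -ltr_expR lnK ?posrE //.
have -> : 2 / 3 = 10%:R * (15^-1) :> R by field.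
rewrite expRM_natl.
have H : expR (15^-1) <= 15 / 14 :> R.
  have := expR_ge1Dx (- 15^-1 : R); rewrite expRN => H.
  have E0 := expR_gt0 (15^-1 : R).
  rewrite -(invrK (expR _)) -[15/14]invrK lef_pV2 ?posrE ?invr_gt0 ?divr_gt0 //.
  by apply: le_trans H; lra.
have K : expR (15^-1) ^+ 10 <= (15 / 14) ^+ 10 :> R.
  by apply: lerXn2r; rewrite ?nnegrE ?expR_ge0 ?divr_ge0.
by apply: le_lt_trans K _; lra.
Qed.

Lemma longest_path_lt_lnln (R : realType) :
  exists n0 : nat, forall n q : nat, (n0 <= n)%N -> (n <= q)%N ->
  (longest_path n q)%:R < 3 * ln (ln n%:R) :> R.
Proof.
have c23 := ln2_gt23 R; set c := ln 2 in c23.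
(* Above [M], [L] satisfies [2 * (L - ln c) / c + 3 < 3 * L]. *)
pose M : R := (3 * c - 2 * ln c) / (3 * c - 2).
exists (Num.trunc (expR (expR M))).+4 => n q n0n nq.
have n0 : (0 < n)%N by apply: leq_trans n0n.
have nR : 0 < n%:R :> R by rewrite ltr0n.
have ML : M < ln (ln n%:R).
  have EM : expR (expR M) < n%:R.
    apply: lt_le_trans (truncnS_gt _) _.
    by rewrite ler_nat; apply: leq_trans n0n; rewrite -addn3 leq_addr.
  have E1 : expR M < ln n%:R by rewrite -ltr_expR lnK ?posrE.
  by rewrite -ltr_expR lnK // posrE (lt_trans (expR_gt0 M)).
set L := ln _ in ML *.
have exk : exists k, (n < 2 ^ (2 ^ k))%N.
  by exists n; rewrite (ltn_trans (ltn_expl n (leqnn 2))) // ltn_exp2l // ltn_expl.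
(* Minimality gives [2 ^ (2 ^ k.-1) <= n], which after two logarithms becomes [kL]. *)
case: (ex_minnP exk) => k nk kmin.
have k0 : (0 < k)%N.
  by rewrite lt0n; apply: contraTneq nk => ->; rewrite -leqNgt expn1; lia.
have kn : (2 ^ (2 ^ k.-1) <= n)%N.
  by rewrite leqNgt; apply/negP => /kmin; rewrite -ltnS prednK // ltnn.
have H1 : (longest_path n q < 2 * k.+1)%N.
  by apply: longest_path_lt_of_linear_bias; rewrite // nq andbT; lia.
have cL : 2 ^+ k.-1 * c <= ln n%:R.
  rewrite -natrX mulr_natl -lnXn // ler_ln ?posrE ?exprn_gt0 //.
  by rewrite -natrX ler_nat.
have c0 : 0 < c by lra.
have {cL} kL : k.-1%:R * c + ln c <= L.
  rewrite mulr_natl -lnXn // -lnM ?posrE ?exprn_gt0 // ler_ln ?posrE //.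
    by rewrite mulr_gt0 // exprn_gt0.
  by apply: lt_le_trans cL; rewrite mulr_gt0 // exprn_gt0.
have H2 : (longest_path n q)%:R <= 2 * k.-1%:R + 3 :> R.
  by rewrite -natrM -natrD ler_nat; lia.
apply: le_lt_trans H2 _.
have {}ML : 3 * c - 2 * ln c < L * (3 * c - 2) by rewrite -ltr_pdivrMr //; lra.
rewrite -(ltr_pM2r c0); lra.
Qed.

(** * Client's strategies and depth-first search *)

(** A strategy receives only the history and the offer, so it recomputes [C] and [U] from the
    history and claims an element preserving [Inv]. The defaults [any] and [x0] make it total and
    legal. *)
Lemma guarantee_of_invariant (T : finType) (x0 : T) (q : nat) (X : {set T})
    (Inv : {set T} -> {set T} -> Prop) (goal : {set T} -> Prop) :
  Inv set0 X ->
  (forall C U A : {set T}, Inv C U -> A \subset U -> A != set0 ->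
    (#|A| <= q.+1)%N -> exists2 x, x \in A & Inv (x |: C) (U :\: A)) ->
  (forall C, Inv C set0 -> goal C) ->
  client_can_guarantee q X goal.
Proof.
move=> Inv0 InvS InvG.
pose claimed (h : seq ({set T} * T)) := [set x in map snd h].
pose left (h : seq ({set T} * T)) := foldl (fun U r => U :\: r.1) X h.
pose good h (A : {set T}) x := `[< Inv (x |: claimed h) (left h :\: A) >].
pose any (A : {set T}) := odflt x0 [pick x in A].
pose s (h : seq ({set T} * T)) (A : {set T}) :=
  odflt (any A) [pick x in A | good h A x].
have sL : legal_strategy s.
  move=> h A /set0Pn[x xA]; rewrite /s; case: pickP => [y /= /andP[]//|_] /=.
  by rewrite /any; case: pickP => [//|/(_ x)] /=; rewrite xA.
exists s => // os osL.
suff H h U : Inv (claimed h) U -> left h = U -> legal_play q U os ->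
    Inv (claimed h :|: client_claims s h os) set0.
  have c0 : claimed [::] = set0 by apply/setP=> x; rewrite !inE.
  by have := H [::] X; rewrite c0 set0U => /(_ Inv0 erefl osL)/InvG.
elim: os h U {osL} => [|A os IH] h U /= IU lU.
  by move=> /eqP U0; rewrite setU0 -U0.
case/and4P=> AU; rewrite card_gt0 => A0 Aq osL.
have [x xA Ix] := InvS _ _ _ IU AU A0 Aq.
have {Ix} Is : Inv (s h A |: claimed h) (U :\: A).
  rewrite /s; case: pickP => [y /= /andP[_ /asboolP]|/(_ x)] /=; first by rewrite lU.
  by rewrite xA /= /good lU (asboolT Ix).
have cE : claimed (rcons h (A, s h A)) = s h A |: claimed h.
  by apply/setP=> z; rewrite !inE map_rcons mem_rcons inE.
have := IH (rcons h (A, s h A)) (U :\: A); rewrite cE.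
rewrite setUCA setUA; apply=> //.
by rewrite /left foldl_rcons -/(left h) lU.
Qed.

Section DepthFirstSearch.
Variables (V : finType) (e : rel V) (W : {set V}).
Hypothesis e_sym : symmetric e.

(* The set [S] of finished vertices, the set [T] of unvisited vertices and the
   stack [p] of the search; the last clause says that they partition [W]. *)
Definition dfs_state (S T : {set V}) (p : seq V) : Prop :=
  [/\ sorted e p, uniq p, forall x y, x \in S -> y \in T -> ~~ e x y &
      forall z, ((z \in S) + (z \in T) + (z \in p))%N = (z \in W)].

Lemma dfs_card S T p : dfs_state S T p -> (#|S| + #|T| + size p)%N = #|W|.
Proof.
case=> _ /card_uniqP <- _ H; rewrite -!sum1_card.
rewrite [X in (X + _ + _)%N]big_mkcond [X in (_ + X + _)%N]big_mkcond.
rewrite [X in (_ + _ + X)%N]big_mkcond [RHS]big_mkcond -!big_split /=.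
by apply: eq_bigr => z _; have := H z; do ![case: (z \in _)].
Qed.

(** Each push shrinks [T], so after finitely many pushes the top of the stack has no unvisited
    neighbour and moves to [S]. An empty stack restarts at any unvisited vertex. *)
Lemma dfs_step S T p : dfs_state S T p -> (#|S| < #|W|)%N ->
  exists S' T' p', dfs_state S' T' p' /\ #|S'| = #|S|.+1.
Proof.
have [m] := ubnP #|T|; elim: m S T p => // m IH S T p Tm st SW.
have [sp Up ST part] := st.
have push y : y \in T -> sorted e (y :: p) ->
    exists S' T' p', dfs_state S' T' p' /\ #|S'| = #|S|.+1.
  move=> yT yp; have yH := part y; rewrite yT in yH.
  apply: (IH S (T :\ y) (y :: p)) => //; first by rewrite (cardsD1 y) yT in Tm.
  split=> //=.
  - by rewrite Up andbT; move: yH; case: (y \in p); case: (y \in S); case: (y \in W).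
  - by move=> a b aS /setD1P[_]; apply: ST.
  move=> z; rewrite -part !inE; have [->|] //= := eqVneq z y.
  by move: yH; rewrite yT; do ![case: (_ \in _)].
case: p sp Up st part push => [|x p] /= sp Up st part push.
  have /card_gt0P[y yT] : (0 < #|T|)%N by have := dfs_card st; rewrite /=; lia.
  exact: push yT _.
have [y /andP[yT yx]|noT] := pickP [pred y | (y \in T) && e y x].
  by apply: push yT _; rewrite /= yx.
have xH := part x; rewrite inE eqxx /= in xH.
exists (x |: S), T, p; split.
  case/andP: Up => xp Up; split=> //.
  - exact: path_sorted sp.
  - move=> a b /setU1P[->|aS] bT; last exact: ST.
    by have := noT b; rewrite /= bT e_sym /= => ->.
  move=> z; rewrite -part !inE; have [->|] //= := eqVneq z x.
  by rewrite (negPf xp); move: xH; do ![case: (_ \in _)].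
by rewrite cardsU1; move: xH; do ![case: (_ \in _)].
Qed.

Lemma dfs_exists t : (t <= #|W|)%N ->
  exists S T p, dfs_state S T p /\ #|S| = t.
Proof.
elim: t => [|t IH] tW.
  exists set0, W, [::]; rewrite cards0; split=> //; split=> // [x y|z].
    by rewrite inE.
  by rewrite inE addn0.
have [S [T [p [st St]]]] := IH (ltnW tW).
by have := dfs_step st; rewrite St => /(_ tW).
Qed.

End DepthFirstSearch.

Lemma ex_le_average (R : realDomainType) (T : finType) (A : {set T})
    (f : T -> R) c :
  A != set0 -> \sum_(x in A) f x <= #|A|%:R * c ->
  exists2 x, x \in A & f x <= c.
Proof.
move=> /set0Pn[a aA] Hs.
have [x /andP[xA fx]|H] := pickP [pred x | (x \in A) && (f x <= c)].
  by exists x.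
have : #|A|%:R * c < \sum_(x in A) f x.
  rewrite mulr_natl -sumr_const; apply: ltr_sum.
    by apply/hasP; exists a; rewrite ?mem_index_enum.
  by move=> x xA; have := H x; rewrite /= xA ltNge => /negbT.
by rewrite ltNge Hs.
Qed.

(* If Client picks uniformly at random, then he misses a set [F] with
   probability at most [expR (- #|F| / q.+1)]; the invariant is the
   conditional expectation of the number of missed sets. *)
Lemma client_hits (R : realType) (T : finType) (x0 : T) (q : nat) (X : {set T})
    (I : finType) (P : pred I) (F : I -> {set T}) :
  \sum_(i | P i) expR (- (#|F i :&: X|%:R / q.+1%:R)) < 1 :> R ->
  client_can_guarantee q X
    (fun C => forall i, P i -> exists2 x, x \in F i & x \in C).
Proof.
move=> H1.
pose w (B : {set T}) : R := expR (- (#|B|%:R / q.+1%:R)).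
apply: (guarantee_of_invariant x0 (Inv := fun C U =>
  \sum_(i | P i && [disjoint F i & C]) w (F i :&: U) < 1)).
- by under eq_bigl => i do rewrite -setI_eq0 setI0 eqxx andbT.
- move=> C U A H AU A0 Aq.
  have [|x xA Hx] := @ex_le_average R T A (fun x =>
    \sum_(i | P i && [disjoint F i & x |: C]) w (F i :&: (U :\: A)))
    (\sum_(i | P i && [disjoint F i & C]) w (F i :&: U)) A0; last first.
    by exists x => //; apply: le_lt_trans Hx H.
  have djU x i : [disjoint F i & x |: C] = (x \notin F i) && [disjoint F i & C].
    rewrite disjoint_sym -setI_eq0 setIUl setU_eq0 !setI_eq0 disjoints1.
    by rewrite [X in _ && X]disjoint_sym.
  rewrite (exchange_big_dep (fun i => P i && [disjoint F i & C])) /=; last first.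
    by move=> x i _; rewrite djU => /and3P[-> _ ->].
  (* Set by set: with [m] offered elements inside [F i] and [d] outside, [F i] stays missed for a
     fraction [d / (m + d) <= 1 - m / q.+1 <= expR (- (m / q.+1))] of the choices. *)
  rewrite mulr_sumr; apply: ler_sum => i /andP[Pi di].
  rewrite (eq_bigl (mem (A :\: F i))); last first.
    by move=> x; rewrite !inE djU Pi di /= andbT andbC.
  rewrite sumr_const -[X in X <= _]mulr_natl.
  have FUE : #|F i :&: U| = (#|F i :&: (U :\: A)| + #|A :&: F i|)%N.
    rewrite -[LHS](cardsID A) addnC setIDA; congr (_ + _)%N.
    by rewrite -setIA (setIidPr AU) setIC.
  rewrite /w FUE natrD mulrDl opprD expRD.
  rewrite [expR _ * expR _]mulrC mulrA ler_wpM2r ?expR_ge0 //.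
  rewrite -(cardsID (F i) A) natrD.
  set m := #|A :&: F i|; set d := #|A :\: F i|.
  have q0 : 0 < q.+1%:R :> R by rewrite ltr0n.
  have := expR_ge1Dx (- (m%:R / q.+1%:R) : R).
  have mq : (m + d)%:R <= q.+1%:R :> R by rewrite ler_nat cardsID.
  move=> Hexp.
  apply: (@le_trans _ _ ((m%:R + d%:R) * (1 - m%:R / q.+1%:R))); last first.
    by rewrite ler_wpM2l // -natrD.
  rewrite mulrBr mulr1 lerBrDr addrC lerD2r mulrCA -[leRHS]mulr1 ler_wpM2l //.
  by rewrite ler_pdivrMr // mul1r -natrD.
(* At the end each missed set has weight 1, so a sum below 1 leaves none. *)
- move=> C H i Pi; have [/= E|] := boolP [disjoint F i & C]; last first.
    by case/pred0Pn=> x /andP[]; exists x.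
  move: H; rewrite (bigD1 i) ?Pi //= setI0 /w cards0 mul0r oppr0 expR0.
  by rewrite gtrDl ltNge sumr_ge0 // => j _; rewrite expR_ge0.
Qed.

(** * Nearly spanning paths, part (iv) *)

Lemma bin_le (R : realType) (n k : nat) :
  'C(n, k)%:R * k%:R ^+ k <= (expR 1 * n%:R) ^+ k :> R.
Proof.
(* The quotient of [k ^ k] by k factorial is one term of the exponential series at [k]. *)
have H1 : k%:R ^+ k <= k`!%:R * expR 1 ^+ k :> R.
  case: k => [|k]; first by rewrite !expr0 mulr1.
  have := @expR_ge1Dxn R k.+1%:R k (ler0n _ _).
  rewrite -expRM_natr mul1r => H2.
  have H3 : k.+1%:R ^+ k.+1 / k.+1`!%:R <= expR k.+1%:R :> R by lra.
  by move: H3; rewrite ler_pdivrMr ?ltr0n ?fact_gt0 // mulrC.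
have H2 : ('C(n, k) * k`! <= n ^ k)%N.
  rewrite bin_ffact; elim: k {H1} => // k IH.
  by rewrite ffactnSr expnSr leq_mul // leq_subr.
apply: le_trans (ler_wpM2l _ H1) _; first exact: ler0n.
rewrite mulrA exprMn [leRHS]mulrC ler_wpM2r ?exprn_ge0 ?expR_ge0 //.
by rewrite -natrM -natrX ler_nat.
Qed.

Lemma card_edges_between n (A B : {set 'I_n}) : [disjoint A & B] ->
  #|[set [set x; y] | x in A, y in B]| = (#|A| * #|B|)%N.
Proof.
move=> AB; rewrite curry_imset2X card_in_imset ?cardsX //.
move=> [a b] [c d] /setXP[/= aA bB] /setXP[/= cA dB] E.
have : a \in [set c; d] by rewrite -E set21.
rewrite !inE => /orP[/eqP ac|/eqP ad]; last first.
  by rewrite -ad (disjointFr AB aA) in dB.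
have : b \in [set c; d] by rewrite -E set22.
rewrite !inE => /orP[/eqP bc|/eqP ->]; last by rewrite ac.
by rewrite bc (disjointFr AB cA) in bB.
Qed.

(** The last hypothesis is a union bound over pairs of disjoint [k]-sets, so Client gets an edge
    between any two. When the search has finished [k] vertices, no edge joins [S] to [T], so
    [#|T| < k] and the stack is a path on more than [n - 2 * k] vertices. *)
Lemma longest_path_ge_of_bin (R : realType) (n q k : nat) :
  (0 < k)%N -> (2 * k <= n)%N ->
  'C(n, k)%:R ^+ 2 * expR (- ((k ^ 2)%:R / q.+1%:R)) < 1 :> R ->
  (n - 2 * k <= longest_path n q)%N.
Proof.
move=> k0 kn H.
have n0 : (0 < n)%N by lia.
apply/leq_longest_path => //.
have [|s sL sG] := @client_hits R {set 'I_n} set0 q (complete_edges n)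
  ({set 'I_n} * {set 'I_n})%type
  (fun i => [&& #|i.1| == k, #|i.2| == k & [disjoint i.1 & i.2]])
  (fun i => [set [set x; y] | x in i.1, y in i.2]).
  apply: le_lt_trans H; rewrite expr2 -natrM.
  pose Dk := [set A : {set 'I_n} | #|A| == k]; pose D := setX Dk Dk.
  have -> : ('C(n, k) * 'C(n, k))%N = #|D|.
    by rewrite cardsX card_draws card_ord.
  rewrite mulr_natl -sumr_const.
  rewrite big_mkcond [leRHS]big_mkcond /=; apply: ler_sum => -[A B] _ /=.
  rewrite !inE; case: ifP => [/and3P[/eqP cA /eqP cB AB]|_]; last first.
    by case: ifP; rewrite ?expR_ge0.
  rewrite /= cA cB !eqxx /= (setIidPl _) ?card_edges_between ?cA ?cB ?mulnn //.
  apply/subsetP=> e /imset2P[x y xA yB ->]; rewrite inE cards2.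
  by have [xy|] := eqVneq x y; first by rewrite -xy (disjointFr AB xA) in yB.
exists s => // os /sG; set G := client_claims _ _ _ => HG.
have [||S [T [p [st cS]]]] := @dfs_exists _ (Defs.adjacent G) setT _ k.
- by move=> x y; rewrite /Defs.adjacent setUC.
- by rewrite cardsT card_ord; lia.
have Tk : (#|T| < k)%N.
  rewrite ltnNge; apply/negP => kT.
  have [B BT cB] := ex_subset_card T k.
  have [_ _ ST part] := st.
  have SB : [disjoint S & B].
    apply/pred0P=> x /=; apply/negP => /andP[xS /(subsetP BT) xT].
    by have := part x; rewrite xS xT inE; case: (x \in p).
  have [|_ /imset2P[x y xS yB ->]] := HG (S, B).
    by rewrite /= cS eqxx cB (minn_idPl kT) eqxx SB.
  by apply/negP/ST => //; apply: subsetP yB.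
have := dfs_card st; rewrite cardsT card_ord cS => cp.
have [sp Up _ _] := st.
have {}cp : (n < 2 * k + size p)%N.
  by rewrite -[X in (X < _)%N]cp mul2n -addnn ltn_add2r ltn_add2l.
case: p sp Up cp {st} => [|x p] sp Up cp.
  by rewrite addn0 ltnNge kn in cp.
by rewrite /= addnS ltnS -leq_subLR in cp; exists x, p.
Qed.

Lemma expR1_le4 (R : realType) : expR 1 <= 4 :> R.
Proof.
have := expR_ge1Dx (- 2^-1 : R); rewrite expRN => H.
have E0 := expR_gt0 (2^-1 : R).
have H2 : expR 2^-1 <= 2 :> R.
  by rewrite -lef_pV2 ?posrE //; apply: le_trans H; lra.
have -> : 1 = 2%:R * 2^-1 :> R by field.
rewrite expRM_natl; nra.
Qed.

Lemma longest_path_ge_nearly_spanning (R : realType) :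
  exists2 eps0 : R, 0 < eps0 &
  forall eps : R, 0 < eps -> eps < eps0 ->
  exists n0 : nat, forall n q : nat, (n0 < n)%N ->
  q%:R <= eps * n%:R ->
  (1 - 4 * eps * ln (1 / eps)) * n%:R <= (longest_path n q)%:R.
Proof.
(* This gives [L > 16 >= expR 1 ^+ 2], used to bound the binomial coefficient by
   [expR ((L - 1) * k)]. *)
exists (expR (-16)); first exact: expR_gt0.
move=> eps e0 e16; set L := ln _.
have eE : eps = expR (- L) by rewrite expRN lnK ?posrE ?divr_gt0 // div1r invrK.
have L16 : 16 < L by move: e16; rewrite eE ltr_expR; lra.
have eL : 4 * (eps * L) <= 1.
  have := @expR_ge1Dxn R L 1 (ltW (lt_trans _ L16)) ; rewrite ltr0n => /(_ isT).
  have -> : expR L = eps^-1 by rewrite eE expRN invrK.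
  rewrite -(ler_pM2l e0) divff ?gt_eqF // => H.
  have : eps * L * L <= 2 by move: H; rewrite !factS fact0 !muln1; lra.
  by nra.
pose B := 2 * L / eps.
exists (Num.trunc B).+1 => n q nB qn.
have Bn : B < n%:R.
  by apply: lt_trans (truncnS_gt _) _; rewrite ltr_nat.
have Len : 2 * L < n%:R * eps by rewrite -ltr_pdivrMr.
have n0 : 0 < n%:R :> R by rewrite ltr0n; lia.
(* Losing [2 * k] vertices is then affordable, and [k ^ 2 / q.+1] still exceeds the exponent
   [2 * (L - 1) * k] of the squared binomial bound. *)
pose x := 2 * eps * L * n%:R; pose k := Num.trunc x.
have x0 : 0 <= x by rewrite /x; nra.
have kx : k%:R <= x by rewrite truncn_le.
have xk : x < k%:R + 1 by rewrite natr1 truncnS_gt.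
have xB : 2 * eps * n%:R * L = x by rewrite /x; ring.
have x2 : 2 <= x by rewrite -xB; nra.
have k0 : (0 < k)%N by rewrite -(ltr_nat R); lra.
have kn : (2 * k <= n)%N by rewrite -(ler_nat R) natrM; nra.
have xn : 2 * k%:R <= 4 * eps * L * n%:R by lra.
suff /leq_trans H : (n - 2 * k <= longest_path n q)%N.
  have := H _ (leqnn _); rewrite -(ler_nat R) natrB // natrM; lra.
apply: (@longest_path_ge_of_bin R) => //.
have k0R : 0 < k%:R :> R by rewrite ltr0n.
have CL : 'C(n, k)%:R <= expR ((L - 1) * k%:R).
  rewrite -(ler_pM2r (exprn_gt0 k k0R)); apply: le_trans (bin_le _ _ _) _.
  rewrite expRM_natr -exprMn lerXn2r // ?nnegrE ?mulr_ge0 ?expR_ge0 ?ler0n //.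
  have E4 := expR1_le4 R; have Ep := expR_gt0 (1 : R).
  have -> : expR (L - 1) = (eps * expR 1)^-1.
    by rewrite eE -expRD -expRN; congr expR; ring.
  rewrite -[leRHS]mulrC ler_pdivlMr ?mulr_gt0 //.
  have K : eps * L * n%:R <= k%:R by lra.
  have : (expR 1) ^+ 2 * (eps * n%:R) <= L * (eps * n%:R).
    by rewrite ler_wpM2r ?mulr_ge0 ?ltW //; nra.
  by nra.
have q0 : 0 < q.+1%:R :> R by rewrite ltr0n.
apply: (@le_lt_trans _ _ (expR ((L - 1) * k%:R) ^+ 2 *
    expR (- ((k ^ 2)%:R / q.+1%:R)))).
  by rewrite ler_wpM2r ?expR_ge0 // lerXn2r ?nnegrE ?expR_ge0.
rewrite -expRM_natl -expRD expR_lt1 subr_lt0 ltr_pdivlMr // natrX expr2.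
have : 2 * (L - 1) * q.+1%:R < k%:R by rewrite -natr1; nra.
rewrite -(ltr_pM2r k0R); lra.
Qed.

(** * Locally sparse subgraphs *)

Section SparseSelection.
Variables (R : realFieldType) (T I : finType) (P : pred I) (K : I -> {set T}).
Variable q : nat.

Let p : R := q.+1%:R^-1.

(* The conditional expectation of the size of [H] minus the number of sets
   [K i] included in [H], when Client adds each element of [U] to [H] with
   probability [p]. *)
Definition sparse_potential (H U : {set T}) : R :=
  p * #|U|%:R + #|H|%:R -
  \sum_(i | P i) (K i \subset H :|: U)%:R * p ^+ #|K i :&: U|.

(** Consider [q.+1] equally likely outcomes: one element of [A] is kept, or none. If [L] misses [A],
    nothing changes. If it meets [A] in one element, only that outcome keeps [L] possible, and the
    power of [p] drops by one, which compensates for the factor [q.+1]. If it meets [A] in more, no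
    outcome does. *)
Lemma sparse_term (L H U A : {set T}) : [disjoint H & U] -> A \subset U ->
  \sum_(x in A)
    (L \subset (x |: H) :|: (U :\: A))%:R * p ^+ #|L :&: (U :\: A)| +
  (q.+1%:R - #|A|%:R) *
    ((L \subset H :|: (U :\: A))%:R * p ^+ #|L :&: (U :\: A)|)
  <= q.+1%:R * ((L \subset H :|: U)%:R * p ^+ #|L :&: U|).
Proof.
move=> HU AU.
have p0 : 0 <= p by rewrite invr_ge0.
set g := p ^+ #|L :&: (U :\: A)|.
have g0 : 0 <= g by rewrite exprn_ge0.
have LU : #|L :&: U| = (#|L :&: (U :\: A)| + #|L :&: A|)%N.
  rewrite -[LHS](cardsID A) addnC setIDA; congr (_ + _)%N.
  by rewrite -setIA (setIidPr AU).
have UE : (U :\: A) :|: A = U by rewrite setUC -[X in X :|: _](setIidPr AU) setID.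
have notH x : x \in A -> x \notin H :|: (U :\: A).
  move=> xA; rewrite !inE xA /= orbF.
  by rewrite (disjointFl HU) // (subsetP AU).
have [LA0|[b]] := set_0Vmem (L :&: A).
  have sub x : x \in A ->
      (L \subset (x |: H) :|: (U :\: A)) = (L \subset H :|: (U :\: A)).
    move=> xA; rewrite -setUA; apply/idP/idP => Ls; last first.
      by rewrite (subset_trans Ls) ?subsetUr.
    apply/subsetP=> z zL; have := subsetP Ls z zL.
    rewrite in_setU1 => /predU1P[zx|//].
    by have /setP/(_ x) := LA0; rewrite !inE xA -zx zL.
  under eq_bigr => x xA do rewrite sub //.
  rewrite sumr_const -[(_ * g) *+ _]mulr_natl -mulrDl addrC subrK.
  rewrite LU LA0 cards0 addn0.
  apply: ler_wpM2l => //; apply: ler_wpM2r => //; rewrite ler_nat.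
  case: (boolP (L \subset H :|: (U :\: A))) => // /subset_trans-> //.
  by rewrite setUS ?subsetDl.
move=> /setIP[bL bA].
have nLH : (L \subset H :|: (U :\: A)) = false.
  by apply/negP => /subsetP/(_ b bL); apply/negP/notH.
rewrite nLH mul0r mulr0 addr0 (bigD1 b) //= big1 ?addr0; last first.
  move=> x /andP[xA xb]; case: (boolP (_ \subset _)) => [/subsetP/(_ b bL)|_].
    by rewrite -setUA in_setU1 (negPf (notH b bA)) eq_sym (negPf xb).
  by rewrite mul0r.
case: (boolP (_ \subset (b |: H) :|: _)) => [Ls|_]; last first.
  by rewrite mul0r !mulr_ge0 ?exprn_ge0.
have -> : L \subset H :|: U.
  apply: subset_trans Ls _; rewrite -setUA subUset sub1set inE (subsetP AU) ?orbT //=.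
  by rewrite setUS ?subsetDl.
have LAb : L :&: A = [set b].
  apply/setP=> z; rewrite !inE; apply/andP/eqP => [[zL zA]|->//].
  have := subsetP Ls z zL; rewrite -setUA in_setU1 (negPf (notH z zA)) orbF.
  by move/eqP.
by rewrite LU LAb cards1 addn1 exprS !mul1r mulrA divff ?mul1r // pnatr_eq0.
Qed.

(* In the second summand Client ignores the element that he has to claim. If
   Waiter offers fewer than [q.+1] elements, this keeps the probability of adding
   a given element to [H] equal to [p]. *)
Lemma sparse_potential_step (H U A : {set T}) : [disjoint H & U] -> A \subset U ->
  q.+1%:R * sparse_potential H U <=
  \sum_(x in A) sparse_potential (x |: H) (U :\: A) +
  (q.+1%:R - #|A|%:R) * sparse_potential H (U :\: A).
Proof.
move=> HU AU; rewrite /sparse_potential big_split /= sumrN !mulrBr.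
rewrite (exchange_big_dep P) //=.
have -> : forall a b c d : R, a - b + (c - d) = a + c - (b + d) by move=> *; ring.
apply: lerB.
  rewrite (eq_bigr (fun=> p * #|U :\: A|%:R + #|H|%:R + 1)); last first.
    move=> x xA; rewrite cardsU1 (disjointFl HU) ?(subsetP AU) //= natrD.
    by rewrite addrCA addrC.
  rewrite sumr_const cardsD (setIidPr AU) natrB ?subset_leq_card // -mulr_natl.
  rewrite le_eqVlt; apply/orP; left; apply/eqP; rewrite /p; field.
  by rewrite nat1r pnatr_eq0.
rewrite mulr_sumr mulr_sumr -big_split /=; apply: ler_sum => i Pi.
under eq_bigl => x do rewrite Pi andbT.
exact: sparse_term.
Qed.

(** Some outcome does not lower the potential. If keeping nothing is such an outcome, Client claims
    an arbitrary offered element without adding it to [H]. *)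
Lemma client_sparse (x0 : T) (X : {set T}) :
  client_can_guarantee q X (fun C => exists2 H : {set T}, H \subset C &
    p * #|X|%:R - \sum_(i | P i) p ^+ #|K i| <=
    #|H|%:R - #|[set i in P | K i \subset H]|%:R).
Proof.
pose c0 : R := p * #|X|%:R - \sum_(i | P i) p ^+ #|K i|.
have p0 : 0 <= p by rewrite invr_ge0.
apply: (guarantee_of_invariant x0 (Inv := fun C U => exists H : {set T},
  [/\ H \subset C, [disjoint H & U] & c0 <= sparse_potential H U])).
- exists set0; split; rewrite ?sub0set //; first by rewrite -setI_eq0 set0I.
  rewrite /c0 /sparse_potential cards0 addr0 lerD2l lerN2; apply: ler_sum => i Pi.
  rewrite set0U; case: (boolP (_ \subset _)) => [/setIidPl->|_].
    by rewrite mul1r.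
  by rewrite mul0r exprn_ge0.
- move=> C U A [H [HC HU cH]] AU A0 Aq.
  have HUA : [disjoint H & U :\: A].
    by rewrite disjoint_sym (disjointWl (subsetDl _ _)) // disjoint_sym.
  have [ghost|noghost] := lerP (sparse_potential H U) (sparse_potential H (U :\: A)).
    have /set0Pn[x xA] := A0; exists x => //; exists H; split=> //.
      by rewrite (subset_trans HC) ?subsetUr.
    exact: le_trans cH ghost.
  have [|x xA Hx] := @ex_le_average R T A
      (fun x => - sparse_potential (x |: H) (U :\: A)) (- sparse_potential H U) A0.
    rewrite sumrN mulrN lerN2.
    have := sparse_potential_step HU AU.
    have : (q.+1%:R - #|A|%:R) * sparse_potential H (U :\: A) <=
           (q.+1%:R - #|A|%:R) * sparse_potential H U.
      by rewrite ler_wpM2l ?(ltW noghost) // subr_ge0 ler_nat.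
    lra.
  exists x => //; exists (x |: H); split; first by rewrite setUS.
    apply/pred0P=> z /=; rewrite !inE; have [->|_] /= := eqVneq z x.
      by rewrite xA.
    by have := disjointFr HU (x := z); case: (z \in H) => //= ->; rewrite ?andbF.
  by apply: le_trans cH _; rewrite -lerN2.
- move=> C [H [HC _ cH]]; exists H => //; apply: le_trans cH _.
  rewrite /sparse_potential cards0 mulr0 add0r lerD2l lerN2 setU0.
  rewrite -sum1_card natr_sum big_mkcond [leRHS]big_mkcond /=; apply: ler_sum => i _.
  rewrite inE setI0 cards0 expr0 mulr1; case: (i \in P) (unfold_in i P) => //= <- //.
  by case: (_ \subset _).
Qed.

End SparseSelection.

(** One element [c i] is deleted from each bad set, so at most as many elements disappear as there
    are bad sets. *)
Lemma delete_bad_sets (T I : finType) (P : pred I) (K : I -> {set T})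
    (H : {set T}) :
  (forall i, P i -> K i != set0) ->
  exists H' : {set T}, [/\ H' \subset H, forall i, P i -> ~~ (K i \subset H') &
    (#|H| <= #|H'| + #|[set i in P | K i \subset H]|)%N].
Proof.
move=> K0; pose B := [set i in P | K i \subset H].
pose c i := [pick x in K i].
have cK i x : c i = Some x -> x \in K i by rewrite /c; case: pickP => // y yK [<-].
pose D := [set x | [exists i, (i \in B) && (c i == Some x)]].
exists (H :\: D); split; first exact: subsetDl.
  move=> i Pi; apply/negP => KH; have [x cx] : exists x, c i = Some x.
    rewrite /c; case: pickP => [x _|K00]; first by exists x.
    by have /set0Pn[x] := K0 i Pi; rewrite K00.
  have := subsetP KH x (cK _ _ cx); rewrite !inE => /andP[/existsP[]]; exists i.
  rewrite cx eqxx andbT inE [in X in X && _]unfold_in Pi.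
  by rewrite (subset_trans KH) ?subsetDl.
have DB : (#|D| <= #|B|)%N.
  have Sinj : injective (@Some T) by move=> ? ? [].
  rewrite -(card_imset _ Sinj); apply: leq_trans (leq_imset_card c B).
  apply/subset_leq_card/subsetP=> _ /imsetP[x + ->].
  by rewrite inE => /existsP[i /andP[iB /eqP <-]]; apply: imset_f.
rewrite -(cardsID D H) addnC leq_add2l (leq_trans _ DB) //.
by rewrite subset_leq_card ?subsetIr.
Qed.


(* In a vertex set [W] maximizing [#|G :&: pairs W| - c * #|W|], a subset [S]
   of [W] meets at least [c * #|S|] edges. When depth-first search in [W] has finished
   [t] vertices, the edges at these vertices lie in their union with the stack,
   so that local sparsity makes the stack long. *)
Lemma path_of_locally_sparse (R : realDomainType) n (G : {set {set 'I_n}})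
    (c d : R) (N t l : nat) :
  G \subset complete_edges n ->
  (forall S : {set 'I_n}, (0 < #|S| <= N)%N ->
    #|G :&: pairs S|%:R <= d * #|S|%:R) ->
  c * n%:R < #|G|%:R -> 0 <= d <= c -> (t + t <= N)%N -> (l <= t)%N ->
  d * l%:R < (c - d) * t%:R ->
  has_path_of_length_ge l G.
Proof.
move=> GE sparse dense /andP[d0 dc] tN lt_l dl.
pose f (W : {set 'I_n}) : R := #|G :&: pairs W|%:R - c * #|W|%:R.
have [W _ Wmax] : exists2 W, W \in predT & forall V, f V <= f W.
  case: (@arg_maxP _ _ _ [set: 'I_n] predT f isT) => W _ HW.
  by exists W => // V; apply: HW.
have f0 : 0 < f W.
  apply: lt_le_trans (Wmax setT).
  by rewrite /f -pairs_setT (setIidPl GE) cardsT card_ord subr_gt0.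
(* Sets of at most [N] vertices have [f <= 0], because [d <= c]. *)
have NW : (N < #|W|)%N.
  rewrite ltnNge; apply/negP => WN; move: f0; rewrite /f ltNge; case/negP.
  rewrite subr_le0; have [W0|W0] := posnP #|W|.
    rewrite W0 mulr0 lern0 -leqn0 (leq_trans (subset_leq_card (subsetIr _ _))) //.
    by rewrite card_pairs W0.
  by apply: le_trans (sparse W _) _; rewrite ?W0 // ler_wpM2r.
have [||S [T [p [st cS]]]] := @dfs_exists _ (Defs.adjacent G) W _ t.
- by move=> x y; rewrite /Defs.adjacent setUC.
- by rewrite (leq_trans _ (ltnW NW)) // (leq_trans _ tN) ?leq_addr.
have [sp Up ST part] := st.
have [lp|pl] := ltnP l (size p).
  case: p sp Up lp {st part} => // x p sp Up lp.
  by exists x, p.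
have t0 : (0 < t)%N.
  by rewrite lt0n; apply: contraTneq dl => ->; rewrite mulr0 -leNgt mulr_ge0.
pose B := S :|: [set x in p].
have cB : (#|B| <= t + size p)%N.
  rewrite cardsU cS cardsE; have /card_uniqP -> := Up.
  exact: leq_subr.
have SB : S \subset B by rewrite subsetUl.
have WGB : G :&: pairs W :\: pairs (W :\: S) \subset G :&: pairs B.
  apply/subsetP=> e; rewrite !inE => /andP[+ /and3P[eG eW c2]].
  rewrite c2 eG andbT /= subsetD eW /= => /pred0Pn[x /= /andP[xe xS]].
  have /cards1P[y ey] : #|e :\ x| == 1%N by rewrite (cardsD1 x) xe in c2.
  have eE : e = [set x; y] by rewrite -ey setD1K.
  rewrite andbT; apply/subsetP=> z; rewrite eE !inE => /orP[/eqP->|/eqP zy].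
    by rewrite xS.
  have zW : z \in W by rewrite (subsetP eW) // eE zy set22.
  have := part z; rewrite zW; case: (z \in S) => //=.
  case zT: (z \in T) => //=; last by case: (z \in p).
  by have := ST _ _ xS zT; rewrite /Defs.adjacent zy -eE eG.
(* Maximality of [W] against [W :\: S] gives [c * t <= #|G :&: pairs B|], sparsity bounds this by
   [d * #|B|], and a stack of at most [l] vertices makes that too small. *)
have /negP[] : ~~ (c * t%:R <= d * (t + size p)%:R).
  rewrite -ltNge natrD mulrDr -ltrBrDl -mulrBl; apply: le_lt_trans dl.
  by rewrite ler_wpM2l // ler_nat.
apply: (@le_trans _ _ (d * #|B|%:R)); last by rewrite ler_wpM2l // ler_nat.
have B0 : (0 < #|B| <= N)%N.
  rewrite (leq_trans cB) ?(leq_trans _ tN) ?leq_add2l ?(leq_trans pl) // andbT.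
  by apply: leq_trans (subset_leq_card SB); rewrite cS.
apply: le_trans (sparse B B0).
apply: (@le_trans _ _ (#|G :&: pairs W|%:R - #|G :&: pairs (W :\: S)|%:R)).
  have := Wmax (W :\: S); rewrite /f cardsD.
  have SW : S \subset W.
    by apply/subsetP=> x xS; have := part x; rewrite xS; case: (x \in W).
  rewrite (setIidPr SW) natrB ?subset_leq_card // cS mulrBr.
  move: (_%:R) (c * _%:R) (_%:R) (c * _) => a1 a2 a3 a4; clear; lra.
rewrite lerBlDr -natrD ler_nat.
rewrite -(cardsID (pairs (W :\: S)) (G :&: pairs W)) addnC leq_add //.
  by rewrite subset_leq_card // (subset_trans _ WGB).
by rewrite subset_leq_card // setSI // subsetIl.
Qed.

(** * Expected number of dense vertex sets, and part (iii) *)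

Lemma sum_by_card (R : nzRingType) n (f : nat -> R) :
  \sum_(S : {set 'I_n}) f #|S| = \sum_(s < n.+1) 'C(n, s)%:R * f s.
Proof.
rewrite (partition_big (fun S : {set 'I_n} => inord #|S| : 'I_n.+1) predT) //=.
apply: eq_bigr => s _.
have Sn (S : {set 'I_n}) : (#|S| < n.+1)%N 
  by rewrite ltnS; have := max_card (mem S); rewrite card_ord.
rewrite (eq_bigl (fun S : {set 'I_n} => #|S| == s :> nat)); last first.
  by move=> S; rewrite -val_eqE /= inordK.
rewrite (eq_bigr (fun=> f s)) => [|S /eqP->//].
rewrite (eq_bigl (mem [set S : {set 'I_n} | #|S| == s :> nat])); last first.
  by move=> S; rewrite !inE.
by rewrite sumr_const card_draws card_ord mulr_natl.
Qed.

(** The forbidden sets are the sets of [m #|S|] pairs inside a small [S], indexed together with [S].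
    The sum is the bound on the expected number that are kept, and one edge is deleted from each. *)
Lemma client_locally_sparse (R : realFieldType) (n q N : nat) (m : nat -> nat)
    (c : R) :
  (forall s, 0 < m s)%N ->
  \sum_(s < n.+1 | (0 < s <= N)%N)
    'C(n, s)%:R * ('C('C(s, 2), m s)%:R * q.+1%:R^-1 ^+ m s) <= c ->
  client_can_guarantee q (complete_edges n) (fun C =>
    exists G : {set {set 'I_n}},
    [/\ G \subset C, 'C(n, 2)%:R / q.+1%:R - c <= #|G|%:R :> R &
      forall S : {set 'I_n}, (0 < #|S| <= N)%N ->
        (#|G :&: pairs S| < m #|S|)%N]).
Proof.
move=> m0 Hc.
pose P (i : {set 'I_n} * {set {set 'I_n}}) :=
  [&& (0 < #|i.1| <= N)%N, i.2 \subset pairs i.1 & #|i.2| == m #|i.1|].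
have [s sL sG] := @client_sparse R _ _ P snd q set0 (complete_edges n).
exists s => // os /sG[H HC cH].
have [i /and3P[_ _ /eqP ci]|H' [H'H noK cH']] := @delete_bad_sets _ _ P snd H.
  by rewrite -card_gt0 ci m0.
exists H'; split; first exact: subset_trans HC.
  have cX : #|complete_edges n| = 'C(n, 2).
    by rewrite /complete_edges card_draws card_ord.
  rewrite cX in cH.
  have {}cH' : #|H|%:R - #|[set i in P | i.2 \subset H]|%:R <= #|H'|%:R :> R.
    by rewrite lerBlDr -natrD ler_nat.
  apply: le_trans cH'; apply: le_trans cH; rewrite mulrC lerD2l lerN2.
  apply: le_trans Hc.
  pose f j : R := if (0 < j <= N)%N
    then 'C('C(j, 2), m j)%:R * q.+1%:R^-1 ^+ m j else 0.
  have -> : \sum_(s < n.+1 | (0 < s <= N)%N) 'C(n, s)%:R *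
      ('C('C(s, 2), m s)%:R * q.+1%:R^-1 ^+ m s) =
      \sum_(s < n.+1) 'C(n, s)%:R * f s.
    rewrite [LHS]big_mkcond /=; apply: eq_bigr => j _; rewrite /f.
    by case: ifP => //; rewrite mulr0.
  rewrite -sum_by_card le_eqVlt; apply/orP; left; apply/eqP.
  rewrite -(pair_big_dep (fun S : {set 'I_n} => (0 < #|S| <= N)%N)
     (fun S (L : {set {set 'I_n}}) => (L \subset pairs S) && (#|L| == m #|S|))
     (fun _ L => q.+1%:R^-1 ^+ #|L|)) /=.
  rewrite big_mkcond /=; apply: eq_bigr => S _; rewrite /f; case: ifP => // _.
  rewrite (eq_bigr (fun=> q.+1%:R^-1 ^+ m #|S|)) => [|L /andP[_ /eqP->] //].
  rewrite (eq_bigl (mem [set L : {set {set 'I_n}} |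
    (L \subset pairs S) & (#|L| == m #|S|)])); last first.
    by move=> L; rewrite !inE.
  by rewrite sumr_const cards_draws card_pairs mulr_natl.
move=> S SN; rewrite ltnNge; apply/negP => mS.
have [L LS cL] := ex_subset_card (H' :&: pairs S) (m #|S|).
have /noK/negP[] : P (S, L).
  by rewrite /P SN /= cL (minn_idPl mS) eqxx (subset_trans LS) ?subsetIr.
by rewrite (subset_trans LS) ?subsetIl.
Qed.

Lemma has_path_mono n l (G C : {set {set 'I_n}}) : G \subset C ->
  has_path_of_length_ge l G -> has_path_of_length_ge l C.
Proof.
move=> GC [x [p [pP Up lp]]]; exists x, p; split=> //.
by apply: sub_path pP => a b; apply: (subsetP GC).
Qed.

Lemma bin2_double n : ('C(n, 2) * 2 = n * n.-1)%N.
Proof. by rewrite -[2%N]/(2`!) bin_ffact ffactnS ffactn1. Qed.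

(** As 48 is [2 * 6 * 4] and [expR 1 <= 4], this gives [6 * expR 1 * expR (- 5) <= 2^-1]. *)
Lemma expR5_ge48 (R : realType) : 48 <= expR 5 :> R.
Proof.
have H : 3 / 2 <= expR 2^-1 :> R by have := expR_ge1Dx (2^-1 : R); lra.
have -> : 5 = 10%:R * 2^-1 :> R by field.
rewrite expRM_natl.
have : (3 / 2) ^+ 10 <= (expR 2^-1) ^+ 10 :> R.
  by apply: lerXn2r; rewrite ?nnegrE ?expR_ge0 ?divr_ge0.
by apply: le_trans; lra.
Qed.

Lemma sum_half_le2 (R : realFieldType) n (P : pred 'I_n) :
  \sum_(s < n | P s) 2^-1 ^+ s <= 2 :> R.
Proof.
apply: (@le_trans _ _ (\sum_(s < n) 2^-1 ^+ s)).
  rewrite [leLHS]big_mkcond; apply: ler_sum => s _.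
  by case: ifP; rewrite ?exprn_ge0 ?invr_ge0.
have -> : \sum_(s < n) 2^-1 ^+ s = 2 - 2 * 2^-1 ^+ n :> R.
  elim: n {P} => [|n IH]; first by rewrite big_ord0 expr0; ring.
  by rewrite big_ord_recr /= IH exprS; field.
by rewrite gerBl mulr_ge0 ?exprn_ge0 ?invr_ge0.
Qed.

(** With [y = 6 * s / n], the factors are at most [(expR 1 * n / s) ^+ s] and [y ^+ m]. Their
    product is [(6 * expR 1) ^+ s * y ^+ (m - s)], and [y <= expR (- b)] bounds the last power by
    [expR (- 5) ^+ s]. *)
Lemma expected_dense_sets_le (R : realType) (n s m : nat) (p b : R) :
  (0 < n)%N -> (0 < s)%N -> (s <= m)%N -> 0 <= p -> p * n%:R <= 3 ->
  6 * s%:R <= expR (- b) * n%:R -> 5 * s%:R <= b * (m - s)%:R ->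
  'C(n, s)%:R * ('C('C(s, 2), m)%:R * p ^+ m) <= 2^-1 ^+ s.
Proof.
move=> n0 s0 sm p0 pn sn bm.
have e4 := expR1_le4 R; have e0 := expR_gt0 (1 : R).
have nR : 0 < n%:R :> R by rewrite ltr0n.
have sR : 0 < s%:R :> R by rewrite ltr0n.
have mR : 0 < m%:R :> R by rewrite ltr0n (leq_trans s0).
have smR : s%:R <= m%:R :> R by rewrite ler_nat.
pose y : R := 6 * s%:R / n%:R.
have y0 : 0 <= y by rewrite divr_ge0 ?mulr_ge0 ?ltW.
have H1 : 'C(n, s)%:R <= (expR 1 * n%:R / s%:R) ^+ s :> R.
  by rewrite expr_div_n ler_pdivlMr ?exprn_gt0 // bin_le.
have c2 : 'C(s, 2)%:R * 2 <= s%:R * s%:R :> R.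
  by rewrite -!natrM ler_nat bin2_double leq_mul2l leq_pred orbT.
have H2 : 'C('C(s, 2), m)%:R * p ^+ m <= y ^+ m :> R.
  have H3 : 'C('C(s, 2), m)%:R <= (expR 1 * (s%:R / 2)) ^+ m :> R.
    rewrite -(ler_pM2r (exprn_gt0 m mR)); apply: le_trans (bin_le _ _ _) _.
    rewrite -exprMn; apply: lerXn2r; rewrite ?nnegrE ?mulr_ge0 ?expR_ge0 ?invr_ge0 //.
    by rewrite -mulrA ler_pM2l //; nra.
  apply: le_trans (ler_wpM2r _ H3) _; first by rewrite exprn_ge0.
  rewrite -exprMn; apply: lerXn2r; rewrite ?nnegrE ?mulr_ge0 ?expR_ge0 ?invr_ge0 //.
  rewrite /y ler_pdivlMr // -mulrA.
  have es : expR 1 * (s%:R / 2) <= 4 * (s%:R / 2) :> R.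
    by rewrite ler_wpM2r ?divr_ge0.
  apply: le_trans (ler_pM _ _ es pn) _; last by lra.
    by rewrite !mulr_ge0 ?invr_ge0 // ltW.
  by rewrite mulr_ge0 // ltW.
apply: (@le_trans _ _ ((expR 1 * n%:R / s%:R) ^+ s * y ^+ m)).
  by apply: ler_pM => //; rewrite ?mulr_ge0 ?exprn_ge0.
rewrite -[X in y ^+ X](subnKC sm) exprD mulrA -exprMn.
have -> : expR 1 * n%:R / s%:R * y = 6 * expR 1.
  by rewrite /y; field; rewrite ?lt0r_neq0 ?sR ?nR.
have ye : y <= expR (- b) by rewrite ler_pdivrMr.
have H4 : y ^+ (m - s) <= expR (- 5) ^+ s.
  apply: (@le_trans _ _ (expR (- b) ^+ (m - s))).
    by rewrite lerXn2r ?nnegrE ?expR_ge0.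
  by rewrite -!expRM_natr ler_expR !mulNr lerN2.
apply: (@le_trans _ _ ((6 * expR 1) ^+ s * expR (- 5) ^+ s)).
  by rewrite ler_wpM2l // exprn_ge0 // mulr_ge0 // ltW.
rewrite -exprMn; apply: lerXn2r; rewrite ?nnegrE ?mulr_ge0 ?expR_ge0 ?invr_ge0 //.
rewrite expRN ler_pdivrMr ?expR_gt0 //.
have := expR5_ge48 R; lra.
Qed.

Lemma longest_path_ge_linear (R : realType) : exists2 eps0 : R, 0 < eps0 &
  forall eps : R, 0 < eps -> eps < eps0 ->
  exists n0 : nat, forall n q : nat, (n0 < n)%N ->
  q%:R <= (1 - eps) * (n%:R / 2) ->
  expR (- 12 / eps) * n%:R <= (longest_path n q)%:R.
Proof.
exists (1 / 100); first by lra.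
move=> eps e0 e1.
(* Here [b * (eps / 2) = 5], where [eps / 2] is the excess density that [m] allows. *)
pose b := 10 / eps; pose z := expR (- b).
have z0 : 0 < z := expR_gt0 _.
have b0 : 0 < b by rewrite divr_gt0.
have z1 : z < 1 by rewrite expR_lt1 oppr_lt0.
(* The first term makes the rounding of [t] and [l] harmless, the second serves the edge count. *)
pose B := 120 / (eps * z) + 9 / (eps * eps).
exists (Num.trunc B).+1 => n q nB qn.
have Bn : B < n%:R by apply: lt_trans (truncnS_gt _) _; rewrite ltr_nat.
have [B1 B2] : 120 < n%:R * (eps * z) /\ 9 < n%:R * (eps * eps).
  split; rewrite -ltr_pdivrMr ?mulr_gt0 //; apply: le_lt_trans Bn.
    by rewrite lerDl divr_ge0 ?mulr_ge0 ?ltW.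
  by rewrite lerDr divr_ge0 ?mulr_ge0 ?ltW.
have n0 : (0 < n)%N by apply: leq_trans nB.
have nR : 0 < n%:R :> R by rewrite ltr0n.
(* By monotonicity Client may face the largest admissible bias, which keeps [n / Q.+1] close to
   [2 / (1 - eps)]. *)
pose Q := Num.trunc ((1 - eps) * (n%:R / 2)).
have x0 : 0 <= (1 - eps) * (n%:R / 2) by rewrite mulr_ge0 //; lra.
have qQ : (q <= Q)%N by rewrite truncn_ge_nat.
have Q1 : (1 - eps) * (n%:R / 2) < Q.+1%:R by exact: truncnS_gt.
have Q2 : Q.+1%:R <= (1 - eps) * (n%:R / 2) + 1 by rewrite -natr1 lerD2r truncn_le.
have QR : 0 < Q.+1%:R :> R by rewrite ltr0n.
pose N := Num.trunc (z * n%:R / 6); pose t := Num.trunc (z * n%:R / 12).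
pose w := expR (- 12 / eps); pose l := (Num.trunc (w * n%:R)).+1.
pose m s := (s + (Num.trunc (eps / 2 * s%:R)).+1)%N.
have wl : w * n%:R <= l%:R by rewrite ltW // truncnS_gt.
apply: le_trans wl _; rewrite ler_nat.
apply: leq_trans (longest_path_anti n0 qQ).
apply/leq_longest_path => //.
have Hsum : \sum_(s < n.+1 | (0 < s <= N)%N) 'C(n, s)%:R *
    ('C('C(s, 2), m s)%:R * Q.+1%:R^-1 ^+ m s) <= 2 :> R.
  apply: le_trans (sum_half_le2 _ _); apply: ler_sum => s /andP[s0 sN].
  apply: (expected_dense_sets_le (b := b)) => //.
  - by rewrite leq_addr.
  - by rewrite invr_ge0.
  - by rewrite mulrC ler_pdivrMr //; nra.
  - have : s%:R <= N%:R :> R by rewrite ler_nat.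
    have : N%:R <= z * n%:R / 6 by rewrite truncn_le divr_ge0 ?mulr_ge0 ?ltW.
    by rewrite -/z; lra.
  - rewrite /m addKn.
    apply: le_trans (ler_wpM2l (ltW b0) (ltW (truncnS_gt _))).
    by rewrite le_eqVlt; apply/orP; left; apply/eqP; rewrite /b; field; rewrite gt_eqF.
have m0 s : (0 < m s)%N by rewrite /m addnS.
have [s sL sG] := @client_locally_sparse R n Q N m 2 m0 Hsum.
exists s => // os osL; have [G [GC cG sparse]] := sG os osL.
have GX : G \subset complete_edges n by apply: subset_trans GC (claims_sub _ sL osL).
apply: (has_path_mono GC).
have tz : t%:R <= z * n%:R / 12 by rewrite truncn_le divr_ge0 ?mulr_ge0 ?ltW.
have zt : z * n%:R / 12 < t%:R + 1 by rewrite natr1 truncnS_gt.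
have lw : l%:R <= w * n%:R + 1 by rewrite -natr1 lerD2r truncn_le mulr_ge0 ?expR_ge0.
(* The spare factor [expR (- (2 / eps))], bounded by the quadratic term of the series, makes [l]
   small compared with [eps * t]. *)
have wz : w <= z * (eps * eps / 2).
  have -> : w = z * expR (- (2 / eps)).
    by rewrite -expRD; congr expR; rewrite /b; field; rewrite gt_eqF.
  rewrite ler_pM2l // expRN -[leRHS]invrK.
  rewrite lef_pV2 ?posrE ?expR_gt0 ?invr_gt0 ?divr_gt0 ?mulr_gt0 //.
  have e2 : 0 <= 2 / eps by rewrite divr_ge0 // ltW.
  have := expR_ge1Dxn 1 e2.
  apply: le_trans; rewrite !factS fact0 !muln1 invf_div.
  have -> : (2 / eps) ^+ 2 / 2 = 2 / (eps * eps) by field; rewrite gt_eqF.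
  by rewrite lerDr.
have lt' : (1 + eps / 2) * l%:R < (1 + eps - (1 + eps / 2)) * t%:R.
  have v120 : 120 < eps * (z * n%:R) by rewrite mulrA mulrC.
  have et : eps * (z * n%:R) / 12 < eps * (t%:R + 1).
    by rewrite -mulrA ltr_pM2l.
  have wv : w * n%:R <= eps * (z * n%:R) / 200.
    apply: le_trans (ler_wpM2r (ltW nR) wz) _.
    have : eps * (eps * (z * n%:R)) <= 1 / 100 * (eps * (z * n%:R)).
      by rewrite ler_wpM2r ?mulr_ge0 ?ltW.
    move: v120; clear; lra.
  have l1 : (1 + eps / 2) * l%:R <= 2 * l%:R.
    by rewrite ler_wpM2r //; move: e0 e1; clear; lra.
  move: l1 et wv v120 lw e0 e1; clear; lra.
have le_lt : (l <= t)%N.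
  rewrite -(ler_nat R) ltW //.
  have H1 : l%:R <= (1 + eps / 2) * l%:R.
    by rewrite ler_peMl //; move: e0; clear; lra.
  have H2 : (1 + eps - (1 + eps / 2)) * t%:R <= t%:R.
    by rewrite ler_piMl //; move: e0 e1; clear; lra.
  exact: le_lt_trans H1 (lt_le_trans lt' H2).
apply: (@path_of_locally_sparse R n G (1 + eps) (1 + eps / 2) N t l) => //.
- move=> S /sparse; rewrite /m addnS ltnS -(ler_nat R) => /le_trans; apply.
  by rewrite natrD mulrDl mul1r lerD2l truncn_le mulr_ge0 // divr_ge0 // ltW.
(* The excess of [n / (1 - eps)] over [(1 + eps) * n] is at least [eps * eps * n], which pays for
   rounding and the constant 2. *)
- apply: lt_le_trans cG; rewrite ltrBrDr ltr_pdivlMr //.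
  have C2 : 'C(n, 2)%:R * 2 = n%:R * (n%:R - 1) :> R.
    by rewrite -natrM bin2_double natrM -subn1 natrB.
  have K : 0 <= (1 + eps) * n%:R + 2.
    by rewrite addr_ge0 // mulr_ge0 ?addr_ge0 // ltW.
  apply: le_lt_trans (ler_wpM2l K Q2) _.
  rewrite -(ltr_pM2r (ltr0n R 2)) C2.
  have n9 : 9 < n%:R :> R.
    have ee : eps <= 1 by move: e1; clear; lra.
    by apply: lt_le_trans B2 _; rewrite ler_piMr ?(ltW nR) ?mulr_ile1 ?(ltW e0).
  have := ltr_pM2l nR 9 (n%:R * (eps * eps)); rewrite B2.
  move: n9; clear; lra.
- by apply/andP; split; move: e0; clear; lra.
- rewrite truncn_ge_nat; first by rewrite natrD; move: tz; clear; lra.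
  by rewrite divr_ge0 // mulr_ge0 // ltW.
Qed.

Theorem theorem1p3 (R : realType) :
  [/\ (forall n k q : nat, (0 < n)%N -> (0 < k)%N -> (0 < q)%N ->
         3 * (n%:R `^ (2 ^+ k / (2 ^+ k - 1))) <= q%:R :> R ->
         (longest_path n q < 2 * k)%N),
      (exists n0 : nat, forall n q : nat, (n0 <= n)%N -> (0 < q)%N ->
         (n <= q)%N ->
         (longest_path n q)%:R < 3 * ln (ln n%:R) :> R),
      (exists2 eps0 : R, 0 < eps0 &
         forall eps : R, 0 < eps -> eps < eps0 ->
         exists n0 : nat, forall n q : nat, (n0 < n)%N -> (0 < q)%N ->
         q%:R <= (1 - eps) * (n%:R / 2) ->
         expR (- 12 / eps) * n%:R <= (longest_path n q)%:R) &
      (exists2 eps0 : R, 0 < eps0 &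
         forall eps : R, 0 < eps -> eps < eps0 ->
         exists n0 : nat, forall n q : nat, (n0 < n)%N -> (0 < q)%N ->
         q%:R <= eps * n%:R ->
         (1 - 4 * eps * ln (1 / eps)) * n%:R <= (longest_path n q)%:R)].
Proof.
split.
- by move=> n k q n0 k0 _; apply: longest_path_lt_powR.
- have [n0 H] := longest_path_lt_lnln R.
  by exists n0 => n q n0n _; apply: H.
- have [eps0 eps0_gt0 H] := longest_path_ge_linear R.
  exists eps0 => // eps e0 e1; have [n0 Hn] := H eps e0 e1.
  by exists n0 => n q n0n _; apply: Hn.
- have [eps0 eps0_gt0 H] := longest_path_ge_nearly_spanning R.
  exists eps0 => // eps e0 e1; have [n0 Hn] := H eps e0 e1.
  by exists n0 => n q n0n _; apply: Hn.
Qed.
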